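(* Let $n\geq 3$, let $S=K[x_1,\dots,x_n]$ be a polynomial ring over a field $K$, and let $Z_2=\operatorname{Im}\partial_2$, where $\partial_\bullet$ is the differential of the Koszul complex $K_\bullet$ on $x_1,\dots,x_n$. Let $F$ be the submodule of $K_2$ generated by the elements $\mathbf e_{i,i+1}-\mathbf e_{i+1,i+2}$, $1\leq i\leq n-2$, let $N=\operatorname{rank}(K_2/F)=\binom n2-(n-2)$, and let $C$ be the $N\times(N-1)$ matrix defined in the context. Then a Bourbaki ideal of $Z_2$ is $$I=(1/a)\,I_{N-1}(C),\qquad\text{where } a=\prod_{i=2}^{n-2}x_i^{\,n-1-i}.$$
   Context: The Koszul complex has $K_j=\bigwedge^j S^n$ with canonical basis $\mathbf e_{i_1,\dots,i_j}=\mathbf e_{i_1}\wedge\dots\wedge\mathbf e_{i_j}$ ($i_1<\dots<i_j$) and $\partial(\mathbf e_{i_1\dots i_j})=\sum_{k=1}^{j}(-1)^{k+1}x_{i_k}\mathbf e_{i_1\dots\widehat{i_k}\dots i_j}$. An ideal $I$ is a Bourbaki ideal of an $S$-module $M$ if there is an exact sequence $0\to F'\to M\to I\to 0$ with $F'$ free. $I_t(C)$ is the ideal generated by the $t$-minors of $C$. Definition of $C$: let $H=\{(i,j)\mid 1\leq i<j\leq n,\ (i,j)\neq(2,3),(3,4),\dots,(n-1,n)\}$. The module $K_2/F$ is free with basis the classes of $\mathbf e_{ij}$, $(i,j)\in H$ (each $\mathbf e_{i,i+1}$ has the same class as $\mathbf e_{12}$). Let $\psi:K_3\to K_2/F$ be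 the composition of $\partial_3$ with the projection $K_2\to K_2/F$, and let $B$ be the matrix representing $\psi$ with respect to the canonical basis of $K_3$ (columns) and $\{\mathbf e_{ij}\mid(i,j)\in H\}$ (rows). Then $C$ is the submatrix of $B$ consisting of all rows, ordered as $\mathbf e_{12}$ followed by $\mathbf e_{i,i+2},\dots,\mathbf e_{i,n}$ for $i=1,\dots,n-2$, and of the columns indexed by $\mathbf e_{j,j+1,j+2},\dots,\mathbf e_{j,j+1,n}$ for $j=1,\dots,n-2$. An empty product equals $1$. *)

(* Defs.v *)
From HB Require Import structures.
From mathcomp Require Import all_boot all_order all_algebra.
From mathcomp Require Import mpoly.
From mathcomp Require Import zify.
From mathcomp Require Import boolp.

Set Implicit Arguments.
Unset Strict Implicit.
Unset Printing Implicit Defensive.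

Import GRing.Theory.
Local Open Scope ring_scope.

(* The image of a linear map, as a module in its own right. *)
Definition im_pred (R : nzRingType) (U V : lmodType R) (f : {linear U -> V}) :
  {pred V} := fun v => `[< exists u, f u = v >].

Lemma im_predP (R : nzRingType) (U V : lmodType R) (f : {linear U -> V}) v :
  reflect (exists u, f u = v) (v \in im_pred f).
Proof. exact: asboolP. Qed.

Lemma im_pred_submod_closed (R : nzRingType) (U V : lmodType R)
  (f : {linear U -> V}) : submod_closed (im_pred f).
Proof.
split; first by apply/im_predP; exists 0; rewrite linear0.
move=> a _ _ /im_predP[u <-] /im_predP[v <-].
by apply/im_predP; exists (a *: u + v); rewrite linearP.
Qed.

HB.instance Definition _ (R : nzRingType) (U V : lmodType R)
    (f : {linear U -> V}) :=
  GRing.isSubmodClosed.Build R V (im_pred f) (im_pred_submod_closed f).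

Definition image_mod (R : nzRingType) (U V : lmodType R) (f : {linear U -> V}) :
  Type := {v : V | v \in im_pred f}.

Section ImageMod.
Variables (R : nzRingType) (U V : lmodType R) (f : {linear U -> V}).
HB.instance Definition _ := SubChoice.on (image_mod f).
HB.instance Definition _ :=
  [SubChoice_isSubLmodule of image_mod f by <:].
End ImageMod.

(* There is an exact sequence 0 -> F' -> M -> I -> 0 with F' free.  Only free
   modules S^r of finite rank are considered: this loses nothing for a finitely
   generated M over a Noetherian ring, as F' embeds into M.  Since I is the
   image of a linear map into S, it is an ideal. *)
Definition bourbaki_ideal (S : comNzRingType) (M : lmodType S) (I : S -> Prop) :
  Prop :=
  exists (r : nat) (alpha : {linear 'rV[S]_r -> M}) (beta : {linear M -> S^o}),
    [/\ injective alpha,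
        forall m, beta m = 0 <-> exists v, alpha v = m
      & forall p : S, I p <-> exists m, beta m = p].

(* I_t(C), the ideal generated by the t-minors of C. *)
Definition increasing (t m : nat) (f : {ffun 'I_t -> 'I_m}) : bool :=
  [forall i : 'I_t, forall j : 'I_t, (i < j)%N ==> (f i < f j)%N].

Definition minors_ideal (S : comNzRingType) (p q : nat) (t : nat)
  (C : 'M[S]_(p, q)) : S -> Prop := fun s =>
  exists c : {ffun 'I_t -> 'I_p} -> {ffun 'I_t -> 'I_q} -> S,
    s = \sum_(f | increasing f) \sum_(g | increasing g)
          c f g * \det (mxsub f g C).

(* (1/a) J; an ideal isomorphic to J when S is a domain, a != 0 and
   J is contained in (a). *)
Definition div_ideal (S : comNzRingType) (a : S) (J : S -> Prop) : S -> Prop :=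
  fun s => J (a * s).

Section Koszul.
Variables (K : fieldType) (n : nat).
Local Notation S := {mpoly K[n]}.

(* K_j is the free module on the j-subsets {i_1 < ... < i_j} of the index set,
   the subset standing for e_{i_1} /\ ... /\ e_{i_j}. *)
Definition ksub (j : nat) : finType := {A : {set 'I_n} | #|A| == j}.

Definition koszul (j : nat) : lmodType S := {ffun ksub j -> S^o}.

(* The junk value 0 is taken when #|A| <> j. *)
Definition kbasis (j : nat) (A : {set 'I_n}) : koszul j :=
  [ffun B => (val B == A)%:R].

(* The k-th element i of A has exactly k - 1 smaller elements of A, hence the
   sign (-1)^(k + 1). *)
Definition kdiff_basis (j : nat) (A : {set 'I_n}) : koszul j.-1 :=
  \sum_(i in A)
    ((-1) ^+ #|[set b in A | (b < i)%N]| * 'X_i : S) *: kbasis j.-1 (A :\ i).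

Definition kdiff (j : nat) (u : koszul j) : koszul j.-1 :=
  \sum_(A : ksub j) (u A : S) *: kdiff_basis j (val A).

Lemma kdiff_is_linear j : linear (@kdiff j).
Proof.
move=> a u v; rewrite /kdiff scaler_sumr -big_split /=.
by apply: eq_bigr => A _; rewrite !ffunE scalerDl scalerA.
Qed.

HB.instance Definition _ j :=
  GRing.isLinear.Build S (koszul j) (koszul j.-1) _ (@kdiff j)
    (@kdiff_is_linear j).

Definition Z2 : lmodType S := image_mod (@kdiff 2).

(* From here on indices are numbered from 1, as natural numbers: the integer
   i stands for the element i - 1 of 'I_n. *)
Definition kidx (s : seq nat) : {set 'I_n} := [set i : 'I_n | i.+1 \in s].

Definition ke (s : seq nat) : koszul (size s) := kbasis (size s) (kidx s).

Definition ke2 (p : nat * nat) : koszul 2 := ke [:: p.1; p.2].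

Definition ke3 (t : nat * nat * nat) : koszul 3 := ke [:: t.1.1; t.1.2; t.2].

Definition inF (u : koszul 2) : Prop :=
  exists c : nat -> S,
    u = \sum_(1 <= i < n.-1) c i *: (ke2 (i, i.+1) - ke2 (i.+1, i.+2)).

Definition rankN : nat := ('C(n, 2) - (n - 2))%N.

Definition Crows : seq (nat * nat) :=
  (1, 2)%N :: [seq (i, k) | i <- iota 1 (n - 2), k <- iota i.+2 (n - i.+1)].

Definition Ccols : seq (nat * nat * nat) :=
  [seq (j, j.+1, k) | j <- iota 1 (n - 2), k <- iota j.+2 (n - j.+1)].

Definition inH (p : nat * nat) : bool :=
  [&& (1 <= p.1)%N, (p.1 < p.2)%N, (p.2 <= n)%N
    & ~~ ((2 <= p.1)%N && (p.2 == p.1.+1))].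

(* The columns of C are the coordinates of psi (e_t), t in Ccols, on the basis
   of K_2 / F formed by the classes of e_h, h in Crows: equality in K_2 / F is
   membership of the difference in F.  See mem_Crows, modF_span and modF_free
   for the basis, is_C_exists_unique for the matrix. *)
Definition is_C (C : 'M[S]_(rankN, rankN.-1)) : Prop :=
  forall t : 'I_rankN.-1,
    inF ((kdiff (ke3 (nth (0, 0, 0)%N Ccols t)) : koszul 2)
         - \sum_(r < rankN) C r t *: ke2 (nth (0, 0)%N Crows r)).

Definition bourbaki_factor : S :=
  \prod_(i < n | (2 <= i.+1 <= n - 2)%N) 'X_i ^+ (n - 1 - i.+1).

(* The next lemmas check that K_2 / F is free on the classes of the e_h, h in
   Crows, that these h are the pairs in inH, and that C exists and is unique. *)
Lemma mem_Crows p : (3 <= n)%N -> (p \in Crows) = inH p.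
Proof.
move=> hn; case: p => i k; rewrite inE /inH /= xpair_eqE; apply/orP/idP.
  case=> [/andP[/eqP-> /eqP->]|]; first by rewrite /= (ltnW hn).
  case/allpairsPdep=> x [y [+ + [-> ->]]]; rewrite !mem_iota => hx hy.
  by apply/and4P; split; try lia; rewrite negb_and; apply/orP; right; lia.
case/and4P=> h1 h2 h3; rewrite negb_and => h4.
case: (altP (k =P i.+1)) => hk; first by left; lia.
right; apply/allpairsPdep; exists i, k; split=> //; rewrite mem_iota; lia.
Qed.

Lemma Crows_uniq : uniq Crows.
Proof.
rewrite cons_uniq; apply/andP; split.
  by apply/negP=> /allpairsPdep[x [y [_ + [e1 e2]]]]; rewrite mem_iota; lia.
apply: allpairs_uniq_dep => [|x _|]; rewrite ?iota_uniq //.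
by move=> [x y] [x' y'] _ _ /= [-> ->].
Qed.

Lemma size_Ccols : size Ccols = 'C(n.-1, 2).
Proof.
rewrite size_allpairs_dep; under eq_map do rewrite size_iota.
rewrite sumnE big_map -bin2_sum -/(iota _ _).
have -> : iota 1 (n - 2) = index_iota 1 n.-1.
  by rewrite /index_iota; congr iota; lia.
case: n => [|[|m]]; [by rewrite !big_geq.. |]; rewrite /= big_add1 /=.
rewrite big_nat_recl // add0n [RHS]big_nat_rev add0n.
by apply: eq_big_nat => i hi; lia.
Qed.

Lemma bin2_pred : (3 <= n)%N -> rankN = 'C(n.-1, 2).+1.
Proof.
move=> hn; rewrite /rankN; case: n hn => [//|m] hm.
by rewrite binS bin1 /=; lia.
Qed.

Lemma size_Ccols_rankN : (3 <= n)%N -> size Ccols = rankN.-1.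
Proof. by move=> hn; rewrite size_Ccols bin2_pred. Qed.

Lemma size_Crows : (3 <= n)%N -> size Crows = rankN.
Proof.
move=> hn; rewrite bin2_pred // -size_Ccols /Ccols.
by rewrite /= !size_allpairs_dep.
Qed.

Definition vpair (p : nat * nat) : bool :=
  [&& (1 <= p.1)%N, (p.1 < p.2)%N & (p.2 <= n)%N].

Definition kcf (u : koszul 2) (p : nat * nat) : S :=
  oapp u 0 (insub (kidx [:: p.1; p.2])).

Definition coordF (u : koszul 2) (p : nat * nat) : S :=
  if p == (1, 2)%N then \sum_(1 <= i < n) kcf u (i, i.+1) else kcf u p.

Lemma kcf_linear a u v p : kcf (a *: u + v) p = a * kcf u p + kcf v p.
Proof.
by rewrite /kcf; case: insub => [B|] /=; rewrite ?ffunE ?mulr0 ?addr0.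
Qed.

Lemma coordF_linear a u v p :
  coordF (a *: u + v) p = a * coordF u p + coordF v p.
Proof.
rewrite /coordF; case: ifP => _; last exact: kcf_linear.
by rewrite mulr_sumr -big_split; apply: eq_bigr => i _; rewrite kcf_linear.
Qed.

Lemma coordFD u v p : coordF (u + v) p = coordF u p + coordF v p.
Proof. by rewrite -[u]scale1r coordF_linear mul1r scale1r. Qed.

Lemma coordF0 p : coordF 0 p = 0.
Proof. by apply: (addrI (coordF 0 p)); rewrite -coordFD !addr0. Qed.

Lemma coordFZ a u p : coordF (a *: u) p = a * coordF u p.
Proof. by rewrite -[_ *: _]addr0 coordF_linear coordF0 addr0. Qed.

Lemma coordF_sum (I : Type) (s : seq I) (f : I -> koszul 2) p :
  coordF (\sum_(i <- s) f i) p = \sum_(i <- s) coordF (f i) p.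
Proof.
by apply: (big_morph (fun u => coordF u p)) => [u v|];
   rewrite ?coordFD ?coordF0.
Qed.

Lemma mem_kidx p (i : 'I_n) :
  (i \in kidx [:: p.1; p.2]) = (i.+1 == p.1) || (i.+1 == p.2).
Proof. by rewrite inE !inE. Qed.

Lemma vpair_kidx p : vpair p -> exists x y : 'I_n,
  [/\ (x < y)%N, p = (x.+1, y.+1) & kidx [:: p.1; p.2] = [set x; y]].
Proof.
case: p => [[|i] [|j]]; rewrite /vpair ?andbF //= => /andP[hij hj].
have hi : (i < n)%N by lia.
exists (Ordinal hi), (Ordinal hj); split=> //.
by apply/setP=> z; rewrite inE !inE -!val_eqE /= !eqSS.
Qed.

Lemma kidx_card p : vpair p -> #|kidx [:: p.1; p.2]| == 2.
Proof.
case/vpair_kidx=> x [y [hxy _ ->]]; rewrite cards2.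
by rewrite -val_eqE /= neq_ltn hxy.
Qed.

Lemma kidx_inj p q : vpair p -> vpair q ->
  (kidx [:: p.1; p.2] == kidx [:: q.1; q.2]) = (p == q).
Proof.
move=> hp hq; apply/eqP/eqP => [e|-> //].
case: (vpair_kidx hp) => x [y [hxy ep sp]].
case: (vpair_kidx hq) => x' [y' [hxy' eq' sq]].
rewrite sp sq in e.
have := set21 x y; have := set22 x y; rewrite e !inE -!val_eqE /= => h1 h2.
rewrite ep eq'; congr (_.+1, _.+1); lia.
Qed.

Lemma kcf_ke2 p q : vpair p -> vpair q -> kcf (ke2 q) p = (p == q)%:R.
Proof.
move=> hp hq; rewrite /kcf (insubT (fun A : {set 'I_n} => #|A| == 2) (kidx_card hp)) /= ffunE /=.
by rewrite kidx_inj.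
Qed.

Lemma H_vpair p : inH p -> vpair p.
Proof. by rewrite /inH /vpair => /and4P[-> -> ->]. Qed.

Lemma sum_delta (F : nat -> S) j : (1 <= j < n)%N ->
  \sum_(1 <= i < n) (i == j)%:R * F i = F j.
Proof.
move=> hj; rewrite (bigD1_seq j) ?mem_index_iota ?iota_uniq //= eqxx mul1r.
by rewrite big1 ?addr0 // => i /negPf->; rewrite mul0r.
Qed.

Lemma coordF_consec i p : (3 <= n)%N -> (1 <= i < n)%N -> inH p ->
  coordF (ke2 (i, i.+1)) p = (p == (1, 2)%N)%:R.
Proof.
move=> hn hi hp; rewrite /coordF; case: ifP => hp12.
  rewrite -[RHS](sum_delta (fun=> 1) hi); apply: eq_big_nat => j hj.
  rewrite kcf_ke2 ?/vpair /=; try lia.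
  by rewrite mulr1 xpair_eqE eqSS andbb.
rewrite kcf_ke2; [|exact: H_vpair|by rewrite /vpair /=; lia].
case: eqP => // ep; move: hp hp12; rewrite ep /inH /= xpair_eqE; lia.
Qed.

Lemma coordF_basis p q : (3 <= n)%N -> inH p -> inH q ->
  coordF (ke2 q) p = (p == q)%:R.
Proof.
move=> hn hp hq; have [->|q12] := eqVneq q (1, 2)%N.
  by rewrite coordF_consec //; lia.
rewrite /coordF; case: eqP => [->|p12]; last by rewrite kcf_ke2 ?H_vpair.
rewrite eq_sym (negPf q12); apply: big1_seq => i; rewrite mem_index_iota => hi.
rewrite kcf_ke2; [|by rewrite /vpair /=; lia|exact: H_vpair].
case: eqP => // e; move: hq q12; rewrite -e /inH /= xpair_eqE; lia.
Qed.

Lemma coordF_inF u p : (3 <= n)%N -> inH p -> inF u -> coordF u p = 0.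
Proof.
move=> hn hp [c ->]; rewrite coordF_sum; apply: big1_seq => i.
rewrite mem_index_iota => hi; rewrite coordFZ -[- _]scaleN1r coordFD coordFZ.
by rewrite !coordF_consec ?mulN1r ?subrr ?mulr0 //; lia.
Qed.

Lemma inF0 : inF 0.
Proof. by exists (fun=> 0); rewrite big1 // => i _; rewrite scale0r. Qed.

Lemma inFD u v : inF u -> inF v -> inF (u + v).
Proof.
move=> [c ->] [d ->]; exists (fun i => c i + d i).
by rewrite -big_split; apply: eq_bigr => i _; rewrite scalerDl.
Qed.

Lemma inFZ a u : inF u -> inF (a *: u).
Proof.
move=> [c ->]; exists (fun i => a * c i).
by rewrite scaler_sumr; apply: eq_bigr => i _; rewrite scalerA.
Qed.

Lemma inF_gen i : (1 <= i < n.-1)%N ->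
  inF (ke2 (i, i.+1) - ke2 (i.+1, i.+2)).
Proof.
move=> hi; exists (fun j => (j == i)%:R).
rewrite (bigD1_seq i) ?mem_index_iota ?iota_uniq //= eqxx scale1r.
by rewrite big1 ?addr0 // => j /negPf->; rewrite scale0r.
Qed.

Lemma inF_consec i : (1 <= i < n)%N ->
  inF (ke2 (i, i.+1) - ke2 (1, 2)%N).
Proof.
elim: i => // -[|i] IH hi; first by rewrite subrr; exact: inF0.
have h1 : inF (ke2 (i.+1, i.+2) - ke2 (1, 2)%N) by apply: IH; lia.
have h2 : inF (ke2 (i.+1, i.+2) - ke2 (i.+2, i.+3)).
  by apply: inF_gen; lia.
have -> : ke2 (i.+2, i.+3) - ke2 (1, 2)%N =
  (-1) *: (ke2 (i.+1, i.+2) - ke2 (i.+2, i.+3))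
    + (ke2 (i.+1, i.+2) - ke2 (1, 2)%N).
  by rewrite scaleN1r opprB -addrA addKr.
by apply: inFD => //; apply: inFZ.
Qed.

Definition reprF (u : koszul 2) : koszul 2 :=
  u - \sum_(h <- Crows) coordF u h *: ke2 h.

Lemma reprF_linear a u v : reprF (a *: u + v) = a *: reprF u + reprF v.
Proof.
rewrite /reprF scalerBr addrACA -opprD; congr (_ - _).
rewrite scaler_sumr -big_split; apply: eq_bigr => h _.
by rewrite coordF_linear scalerDl scalerA.
Qed.

Lemma reprF_basis p : (3 <= n)%N -> vpair p -> inF (reprF (ke2 p)).
Proof.
move=> hn hp; have h12 : (1, 2)%N \in Crows by rewrite inE eqxx.
have pick q : q \in Crows -> \sum_(h <- Crows) (h == q)%:R *: ke2 h = ke2 q.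
  move=> hq; rewrite (bigD1_seq q) ?Crows_uniq //= eqxx scale1r.
  by rewrite big1 ?addr0 // => i /negPf->; rewrite scale0r.
rewrite /reprF; have [hH|hH] := boolP (inH p).
  rewrite (eq_big_seq (fun h => (h == p)%:R *: ke2 h)) => [|h hh].
    by rewrite pick ?mem_Crows // subrr; exact: inF0.
  by rewrite coordF_basis // -mem_Crows.
have ep : p = (p.1, p.1.+1).
  case: p hp hH => i j; rewrite /inH /vpair /= => hp hH.
  by congr (_, _); lia.
rewrite ep; have hi : (1 <= p.1 < n)%N by move: hp; rewrite ep /vpair /=; lia.
rewrite (eq_big_seq (fun h => (h == (1, 2)%N)%:R *: ke2 h)) => [|h hh].
  by rewrite pick //; exact: inF_consec.
by rewrite coordF_consec // -mem_Crows.
Qed.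

Lemma koszul2_ind (P : koszul 2 -> Prop) : P 0 ->
  (forall a u v, P u -> P v -> P (a *: u + v)) ->
  (forall p, vpair p -> P (ke2 p)) -> forall u, P u.
Proof.
move=> P0 PD Pe u.
have -> : u = \sum_(B : ksub 2) (u B : S) *: kbasis 2 (val B).
  apply/ffunP=> A; rewrite sum_ffunE (bigD1 A) //= big1 => [|B hB].
    by rewrite addr0 !ffunE eqxx [_ *: _]mulr1.
  by rewrite !ffunE val_eqE eq_sym (negPf hB) scaler0.
elim/big_rec: _ => // B v _ Pv; apply: PD => //.
have /cards2P[x [y [hxy eB]]] := valP B.
wlog lt_xy : x y hxy eB / (x < y)%N.
  move=> hw; have [h|h|h] := ltngtP x y; first exact: (hw x y).
    by apply: (hw y x) => //; rewrite 1?eq_sym // setUC.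
  by case/eqP: hxy; exact: val_inj.
have -> : kbasis 2 (val B) = ke2 (x.+1, y.+1).
  rewrite /ke2 /ke eB; congr kbasis.
  by apply/setP=> z; rewrite !inE !eqSS.
by apply: Pe; rewrite /vpair /=; have := ltn_ord y; lia.
Qed.

Lemma modF_span u : (3 <= n)%N ->
  inF (u - \sum_(h <- Crows) coordF u h *: ke2 h).
Proof.
move=> hn; rewrite -/(reprF u); elim/koszul2_ind: u => [|a u v hu hv|p hp].
- rewrite /reprF big1 ?subr0; first exact: inF0.
  by move=> h _; rewrite coordF0 scale0r.
- by rewrite reprF_linear; apply: inFD => //; apply: inFZ.
- exact: reprF_basis.
Qed.

Lemma modF_free (c : nat * nat -> S) : (3 <= n)%N ->
  inF (\sum_(h <- Crows) c h *: ke2 h) -> forall h, h \in Crows -> c h = 0.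
Proof.
move=> hn hF h hh; have hH : inH h by rewrite -mem_Crows.
suff <- : coordF (\sum_(h <- Crows) c h *: ke2 h) h = c h.
  exact: coordF_inF.
have E i : i \in Crows -> coordF (c i *: ke2 i) h = c i * (h == i)%:R.
  by move=> hi; rewrite coordFZ coordF_basis // -mem_Crows.
rewrite coordF_sum; transitivity (\sum_(i <- Crows) c i * (h == i)%:R).
  exact: eq_big_seq.
rewrite (bigD1_seq h) ?Crows_uniq //= eqxx mulr1 big1 ?addr0 // => i.
by rewrite eq_sym => /negPf->; rewrite mulr0.
Qed.

Lemma sum_Crows (G : nat * nat -> koszul 2) : (3 <= n)%N ->
  \sum_(h <- Crows) G h = \sum_(r < rankN) G (nth (0, 0)%N Crows r).
Proof. by move=> hn; rewrite (big_nth (0, 0)%N) size_Crows // big_mkord. Qed.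

Lemma is_C_exists_unique : (3 <= n)%N ->
  exists C, is_C C /\ forall C', is_C C' -> C' = C.
Proof.
move=> hn; pose u t := kdiff (ke3 (nth (0, 0, 0)%N Ccols t)) : koszul 2.
pose C : 'M_(rankN, rankN.-1) :=
  \matrix_(r, t) coordF (u t) (nth (0, 0)%N Crows r).
have CE r t : C r t = coordF (u t) (nth (0, 0)%N Crows r) by rewrite mxE.
have eC (t : 'I_rankN.-1) : \sum_(h <- Crows) coordF (u t) h *: ke2 h
    = \sum_(r < rankN) C r t *: ke2 (nth (0, 0)%N Crows r).
  rewrite (sum_Crows _ hn); apply: eq_bigr => r _.
  by congr (_ *: _); rewrite CE.
exists C; split.
  by move=> t; have h := modF_span (u t) hn; rewrite (eC t) in h; exact: h.
move=> C' hC'; apply/matrixP=> r t; rewrite CE {C CE eC}.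
have hH (s : 'I_rankN) : inH (nth (0, 0)%N Crows s).
  by rewrite -mem_Crows // mem_nth // size_Crows.
have E s : coordF (C' s t *: ke2 (nth (0, 0)%N Crows s)) (nth (0, 0)%N Crows r)
    = C' s t * (r == s)%:R.
  rewrite coordFZ coordF_basis //; congr (_ * _%:R).
  by rewrite nth_uniq ?size_Crows ?Crows_uniq.
have E' : coordF (\sum_(s < rankN) C' s t *: ke2 (nth (0, 0)%N Crows s))
    (nth (0, 0)%N Crows r) = C' r t.
  rewrite coordF_sum; transitivity (\sum_(s < rankN) C' s t * (r == s)%:R).
    by apply: eq_bigr => s _; exact: E.
  rewrite (bigD1 r) //= eqxx mulr1 big1 ?addr0 // => s.
  by rewrite eq_sym => /negPf->; rewrite mulr0.
have := coordF_inF hn (hH r) (hC' t).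
rewrite -[- _]scaleN1r coordFD coordFZ E' mulN1r.
by move=> /eqP; rewrite subr_eq0 => /eqP.
Qed.

End Koszul.

(* Main.v *)
From HB Require Import structures.
Require Import Defs.
From mathcomp Require Import all_boot all_order all_algebra.
From mathcomp Require Import mpoly.
From mathcomp Require Import zify ring.

(** Number the variables x_0, ..., x_{n-1} and identify Z_2, the image of
    the Koszul differential in S^n, with a module of vectors z such that
    x.z = 0.  The submodule F is spanned by the f_i = e_{i,i+1} - e_{i+1,i+2}.
    A vector g defines a functional z |-> g.z on Z_2, whose value on the
    boundary of e_{ij} is the Wronskian x_i g_j - x_j g_i; it kills the
    boundary of F exactly when the consecutive Wronskians
    x_i g_{i+1} - x_{i+1} g_i are all equal.  The polynomial vector g of
    [wsol] has this property, the common value being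
    w = x_1 ... x_{n-2} ([wsol_wronskian]).  So with
    beta(z) = g.z, and alpha(c) the boundary of the combination of the f_i
    with coefficients c, the sequence
    0 -> S^{n-2} -> Z_2 -> S is a complex, and two things remain.

    Exactness.  The boundary of f_i is, up to sign, the i-th row
    (x_{i+1}, -(x_i + x_{i+2}), x_{i+1}) of a tridiagonal matrix, so alpha is
    injective by triangularity ([trid_free]).  If x.z = 0 and g.z = 0, then
    eliminating between these equations yields
    x_1 A = -(x_0 + x_2) g'_0 z_0, where g' is the vector attached to
    x_1, ..., x_{n-1} and g'_0 is up to sign a product of variables other
    than x_1.  Hence x_1 divides z_0, a multiple of
    the first row removes z_0, and the rest of z satisfies the same two
    equations for x_1, ..., x_{n-1} ([trid_exact]).

    The image.  Let phi_h be the value of beta on the boundary of e_h, for h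
    an index of a row of C.  The columns of C are boundaries modulo F, so
    phi C = 0 and, by Cramer's rule, the signed maximal minors of C are
    proportional to phi ([det_row'_left_kernel]).  Without the row of e_{12},
    C is lower triangular with diagonal entries -x_{j+1}, once for each column
    e_{j,j+1,k}; its determinant is therefore a w up to sign ([det_row'0],
    [prod_crow_var]), while phi_{12} = w.  So the minor without row h is
    a phi_h up to sign, a divides I_{N-1}(C), and (1/a) I_{N-1}(C) is the
    ideal of the phi_h, which is the image of beta ([minors_idealP]). *)

Set Implicit Arguments.
Unset Strict Implicit.
Unset Printing Implicit Defensive.

Import GRing.Theory.
Local Open Scope ring_scope.

(** * The second-order recursion and its tridiagonal relations *)

Section Tridiagonal.
Variable R : idomainType.
Implicit Types (x z : nat -> R) (p a : R).

(** A vector indexed by 0, ..., L + 2 whose consecutive Wronskians with [x]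
    all equal x_1 ... x_{L+1}.  Over the field of fractions its entry of index
    j must be x_1 ... x_{L+1} x_j times the sum of the 1 / (x_k x_{k+1}) for
    k < j, plus a multiple of [x]; the multiple is chosen here so that the entry of index 1
    vanishes, which keeps all entries polynomial.  Prepending a variable
    scales the vector by the new x_1 and moves the zero one step to the left.
    Modulo x_1 the result is thus a multiple of [x] past index 0, which is
    what makes [trid_exact] work. *)
Fixpoint wsol (L : nat) x (j : nat) : R :=
  if L is L'.+1 then
    let g := wsol L' (fun i => x i.+1) in
    if j is j'.+1 then x 1%N * g j' - x j'.+1 * g 0%N else x 2 * g 0%N
  else match j with 0 => -1 | 1 => 0 | _ => 1 end.

Lemma wsol0 L x : wsol L x 0 = - \prod_(2 <= k < L.+2) x k.
Proof.
elim: L x => [|L IH] x; first by rewrite big_geq.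
by rewrite /= IH mulrN [in RHS]big_ltn // [in RHS]big_add1.
Qed.

Lemma wsol1 L x : wsol L x 1 = 0.
Proof. by case: L => [|L] //=; rewrite subrr. Qed.

Lemma wsol_wronskian L x j : (j < L.+2)%N ->
  x j * wsol L x j.+1 - x j.+1 * wsol L x j = \prod_(1 <= k < L.+2) x k.
Proof.
elim: L x j => [|L IH] x [|j] hj.
- by rewrite big_nat1 /=; ring.
- have -> : j = 0%N by lia.
  by rewrite big_nat1 /=; ring.
- by rewrite wsol1 mulr0 sub0r wsol0 mulrN opprK [RHS]big_ltn.
rewrite [RHS]big_ltn // big_add1 /= -(IH (fun i => x i.+1) j); last by lia.
by rewrite /=; ring.
Qed.

(** Row [i] of the tridiagonal matrix of the relations
    x_{i+1} (g_i + g_{i+2}) = (x_i + x_{i+2}) g_{i+1}, which say that two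
    consecutive Wronskians of [g] are equal. *)
Definition trid x (i j : nat) : R :=
  (j == i.+1)%:R * (x i + x i.+2) - ((j == i) || (j == i.+2))%:R * x i.+1.

(** Multiplication by [a] is injective on the quotient ring R / (p). *)
Definition regular_mod p a : Prop :=
  forall y, (exists b, a * y = p * b) -> exists b, y = p * b.

Lemma regular_mod_prod p (I : Type) (s : seq I) (P : pred I) (F : I -> R) :
  (forall i, P i -> regular_mod p (F i)) ->
  regular_mod p (\prod_(i <- s | P i) F i).
Proof.
move=> hF; elim/big_rec: _ => [y|i a Pi ha y]; first by rewrite mul1r.
by rewrite -mulrA => /(hF i Pi)/ha.
Qed.

Lemma sum_trid0 L (F : nat -> R) x :
  \sum_(j < L.+3) F j * trid x 0 j.+1
    = F 0%N * (x 0%N + x 2) - F 1%N * x 1%N.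
Proof.
rewrite 2!big_ord_recl big1 => [|j _]; last first.
  by rewrite !lift0 /trid /= !mul0r subrr mulr0.
by rewrite /trid /=; ring.
Qed.

(** Induction on the length.  The two equations force x_1 to divide z_0; the
    multiple of row 0 that cancels z_0 leaves a vector with one entry fewer
    which satisfies both equations for the shifted sequence, the second one
    after cancelling x_1.  The base case is a single relation among three
    variables. *)
Lemma trid_exact L x z :
  (forall k, (k < L.+1)%N -> x k.+1 != 0) ->
  (forall k, (k < L.+1)%N -> regular_mod (x k.+1) (x k + x k.+2)) ->
  (forall i k, (0 < i < k)%N -> (k < L.+2)%N -> regular_mod (x i) (x k)) ->
  \sum_(j < L.+3) x j * z j = 0 -> \sum_(j < L.+3) wsol L x j * z j = 0 ->
  exists c : nat -> R,
    forall j, (j < L.+3)%N -> z j = \sum_(i < L.+1) c i * trid x i j.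
Proof.
elim: L x z => [|L IH] x z hx0 hsum hprod.
  rewrite !big_ord_recl !big_ord0 !lift0 /= => hx hg.
  have e2 : z 2 = z 0%N by apply: subr0_eq; rewrite -hg; ring.
  have [|d hd] := hsum 0%N isT (z 0%N).
    by exists (- z 1%N); rewrite -[LHS]subr0 -hx e2; ring.
  exists (fun=> - d) => j hj; rewrite big_ord1.
  have e1 : z 1%N = - ((x 0%N + x 2) * d).
    apply: (mulfI (hx0 0%N isT)); apply/eqP; rewrite -subr_eq0; apply/eqP.
    by rewrite -[RHS]hx e2 hd; ring.
  by case: j hj => [|[|[|j]]] // _; rewrite ?e2 ?e1 ?hd /trid /=; ring.
rewrite big_ord_recl [in X in _ -> X -> _]big_ord_recl.
under eq_bigr do rewrite lift0.
under [in X in _ -> X -> _]eq_bigr do rewrite lift0 /=.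
set y := fun i => x i.+1; set g := wsol L y => hx hg.
(* By the recursion for wsol, the second equation reads
   x_1 A + g_0 (x_0 + x_2) z_0 = 0, the first one disposing of the terms in
   x_{j+1} z_{j+1}. *)
pose A := \sum_(j < L.+3) g j * z j.+1.
have hB : \sum_(j < L.+3) x j.+1 * z j.+1 = - (x 0%N * z 0%N).
  by apply/eqP; rewrite -addr_eq0 addrC; apply/eqP.
have hA : x 1%N * A = - ((x 0%N + x 2) * (g 0%N * z 0%N)).
  have e : \sum_(i < L.+3) (x 1%N * g i - x i.+1 * g 0%N) * z i.+1
      = x 1%N * A + g 0%N * (x 0%N * z 0%N).
    rewrite -[x 0%N * z 0%N]opprK -hB mulrN !mulr_sumr -sumrB.
    by apply: eq_bigr => i _; ring.
  rewrite e in hg.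
  have {}hg : x 2 * g 0%N * z 0%N + (x 1%N * A + g 0%N * (x 0%N * z 0%N)) = 0 := hg.
  by rewrite -[LHS]subr0 -hg; ring.
have [d hd] : exists d, z 0%N = x 1%N * d.
  have hP : regular_mod (x 1%N) (\prod_(2 <= k < L.+2) x k.+1).
    rewrite big_seq; apply: regular_mod_prod => k; rewrite mem_index_iota => hk.
    by apply: hprod; lia.
  apply: hP; apply: (hsum 0%N isT); exists A.
  by rewrite hA /g wsol0 /y; ring.
have [|||||c hc] := IH y (fun j => z j.+1 + d * trid x 0 j.+1) => //.
- move=> k hk; exact: (hx0 k.+1).
- move=> k hk; exact: (hsum k.+1).
- move=> i k hi hk; apply: (hprod i.+1 k.+1); lia.
- transitivity (\sum_(j < L.+3) (x j.+1 * z j.+1 + d * (x j.+1 * trid x 0 j.+1))).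
    by apply: eq_bigr => j _; rewrite /y; ring.
  by rewrite big_split -mulr_sumr (sum_trid0 L y) hB hd /y /=; ring.
- transitivity (\sum_(j < L.+3) (g j * z j.+1 + d * (g j * trid x 0 j.+1))).
    by apply: eq_bigr => j _; rewrite -/g; ring.
  rewrite big_split -mulr_sumr (sum_trid0 L g) -/A /g wsol1 -/g.
  apply: (mulfI (hx0 0%N isT)); rewrite mulrDr hA hd.
  by ring.
exists (fun i => if i is i'.+1 then c i' else - d) => j hj.
rewrite big_ord_recl; under eq_bigr do rewrite lift0.
rewrite /=.
case: j hj => [|j] hj.
  rewrite big1 => [|i _]; last by rewrite /trid /= mul0r mul0r subrr mulr0.
  by rewrite hd /trid /=; ring.
transitivity (- d * trid x 0 j.+1 + (z j.+1 + d * trid x 0 j.+1)); first by ring.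
by rewrite (hc j hj).
Qed.

(** The square matrix on the columns 0, ..., L - 1 is triangular with
    diagonal entries - x_{i+1}. *)
Lemma trid_free L x (c : nat -> R) :
  (forall k, (k < L)%N -> x k.+1 != 0) ->
  (forall j, (j < L)%N -> \sum_(i < L) c i * trid x i j = 0) ->
  forall i, (i < L)%N -> c i = 0.
Proof.
elim: L x c => [|L IH] x c hx hc i hi //.
have hc0 : c 0%N = 0.
  have := hc 0%N isT; rewrite big_ord_recl big1 => [|k _]; last first.
    by rewrite lift0 /trid /= !mul0r subrr mulr0.
  rewrite addr0 /trid /= mul0r mul1r sub0r mulrN => /eqP.
  by rewrite oppr_eq0 mulf_eq0 (negPf (hx 0%N isT)) orbF => /eqP.
case: i hi => // i hi.
apply: (IH (fun k => x k.+1) (fun k => c k.+1)) => // [k hk|j hj].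
  exact: hx.
have := hc j.+1 hj; rewrite big_ord_recl hc0 mul0r add0r => h; rewrite -[RHS]h.
by apply: eq_bigr => k _; rewrite lift0.
Qed.
End Tridiagonal.

(** * Maximal minors of a matrix with one more row than columns *)

(** An increasing map satisfies i <= h i; the same bound for its conjugate by
    the order reversal is the opposite inequality. *)
Lemma increasing_endo M (h : 'I_M -> 'I_M) :
  (forall i j : 'I_M, (i < j)%N -> (h i < h j)%N) -> h =1 id.
Proof.
have ge (f : 'I_M -> 'I_M) : (forall i j : 'I_M, (i < j)%N -> (f i < f j)%N) ->
    forall i : 'I_M, (i <= f i)%N.
  move=> hf [i hi] /=; elim: i hi => [|i IH] hi //.
  have hi' : (i < M)%N by lia.
  by apply: leq_ltn_trans (IH hi') _; apply: hf.
move=> hh i; apply: val_inj => /=; apply/eqP; rewrite eqn_leq ge // andbT.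
have := ge (fun k => rev_ord (h (rev_ord k))) _ (rev_ord i).
rewrite rev_ordK /= => H; have := ltn_ord i; have := ltn_ord (h i).
have : (M - i.+1 <= M - (h i).+1)%N.
  apply: H => a b ab; have := hh (rev_ord b) (rev_ord a) => /=.
  have := ltn_ord b; have := ltn_ord (h (rev_ord b)).
  by have := ltn_ord (h (rev_ord a)); lia.
lia.
Qed.

Lemma increasing_lift M (f : 'I_M -> 'I_M.+1) :
  (forall i j : 'I_M, (i < j)%N -> (f i < f j)%N) ->
  exists r : 'I_M.+1, f =1 lift r.
Proof.
move=> hf.
have [r hr] : exists r, r \notin codom f.
  apply/existsP; rewrite -negb_forall; apply/negP => /forallP hall.
  have : (#|'I_M.+1| <= #|codom f|)%N.
    by apply: subset_leq_card; apply/subsetP => i _.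
  by move/leq_trans/(_ (leq_image_card _ _)); rewrite !card_ord ltnn.
have neq i : r != f i by apply: contraNneq hr => ->; exact: codom_f.
pose h i := s2val (unlift_some (neq i)).
have hE i : f i = lift r (h i) by rewrite /h; case: (unlift_some _).
exists r => i; rewrite hE (increasing_endo (h := h)) // => j k /hf.
by rewrite !hE /= /bump; lia.
Qed.

Lemma mxsub_lift (R : Type) M k (r : 'I_M.+1) (C : 'M[R]_(M.+1, k)) :
  mxsub (lift r) id C = row' r C.
Proof. by apply/matrixP => i j; rewrite !mxE. Qed.

(** A maximal minor of an (M+1) x M matrix is chosen by the omitted row: an
    increasing map into [M + 1] misses one value, and all the columns are
    used in their order. *)
Lemma minors_ideal_row' (R : comNzRingType) M (C : 'M[R]_(M.+1, M)) (q : R) :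
  minors_ideal M C q <->
  exists c : 'I_M.+1 -> R, q = \sum_r c r * \det (row' r C).
Proof.
have incP k m (f : {ffun 'I_k -> 'I_m}) : increasing f ->
    forall i j : 'I_k, (i < j)%N -> (f i < f j)%N.
  by move=> /forallP h i j; have /forallP/(_ j)/implyP := h i.
have inc_id : increasing [ffun i : 'I_M => i].
  by apply/forallP => i; apply/forallP => j; rewrite !ffunE; apply/implyP.
have inc_lift (r : 'I_M.+1) : increasing [ffun i : 'I_M => lift r i].
  apply/forallP => i; apply/forallP => j; rewrite !ffunE /= /bump.
  by apply/implyP; lia.
split=> [[c ->]|[c ->]].
- apply: (big_ind (fun s : R => exists c, s = \sum_r c r * \det (row' r C))).
  + by exists (fun=> 0); rewrite big1 // => r _; rewrite mul0r.
  + move=> _ _ [c1 ->] [c2 ->]; exists (fun r => c1 r + c2 r).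
    by rewrite -big_split; apply: eq_bigr => r _; rewrite mulrDl.
  move=> f /incP/increasing_lift[r hr].
  exists (fun s => (s == r)%:R * \sum_(g | increasing g) c f g).
  rewrite [RHS](bigD1 r) //= eqxx mul1r [X in _ + X]big1 => [|s sr]; last first.
    by rewrite (negPf sr) !mul0r.
  rewrite addr0 mulr_suml; apply: eq_bigr => g /incP/increasing_endo hg.
  by congr (_ * \det _); apply/matrixP => i j; rewrite !mxE hr hg.
exists (fun f _ => \sum_r (f == [ffun i => lift r i])%:R * c r).
under [RHS]eq_bigr => f hf.
  rewrite (big_pred1 [ffun i : 'I_M => i]); last first.
    move=> g; apply/idP/eqP => [/incP/increasing_endo hg|-> //].
    by apply/ffunP => i; rewrite hg ffunE.
  rewrite mulr_suml; over.
rewrite exchange_big; apply: eq_bigr => r _ /=.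
rewrite (bigD1 [ffun i : 'I_M => lift r i]) //= big1 => [|f /andP[_ /negPf->]].
  rewrite eqxx mul1r addr0 -mxsub_lift; congr (_ * \det _).
  by apply/matrixP => i j; rewrite !mxE !ffunE.
by rewrite !mul0r.
Qed.

(** Cramer's rule.  Put the first unit vector in front of [C], giving a
    square matrix D: the cofactors of its column 0 are the signed maximal
    minors of [C], and phi D = (phi_0, 0, ..., 0).  Multiplying this equality
    by the adjugate of D gives the proportionality. *)
Lemma det_row'_left_kernel (R : comNzRingType) M (C : 'M[R]_(M.+1, M))
    (phi : 'rV[R]_M.+1) (r : 'I_M.+1) : phi *m C = 0 ->
  phi 0 0 * \det (row' r C) = (-1) ^+ r * (phi 0 r * \det (row' 0 C)).
Proof.
move=> hC; pose D : 'M[R]_M.+1 := row_mx (delta_mx 0 0 : 'cV_M.+1) C.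
have cofD s : cofactor D s 0 = (-1) ^+ s * \det (row' s C).
  rewrite /cofactor addn0; congr (_ * \det _).
  apply/matrixP => i j; rewrite !mxE.
  case: splitP => [k|k]; first by rewrite ord1.
  by rewrite /= /bump leq0n !add1n => -[] /val_inj ->.
have detD : \det D = \det (row' 0 C).
  rewrite (expand_det_col D 0) (bigD1 0) //= big1 => [|s /negPf s0].
    rewrite cofD expr0 mul1r addr0 /D mxE; case: splitP => // k _.
    by rewrite ord1 mxE mul1r.
  rewrite /D mxE; case: splitP => [k _|k //].
  by rewrite ord1 mxE s0 mul0r.
have phiD s : (phi *m D) 0 s = (s == 0)%:R * phi 0 0.
  have -> : phi *m D = row_mx (phi *m delta_mx 0 0) (0 : 'rV_M) :> 'rV_(1 + M).
    by rewrite -hC; exact: mul_mx_row.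
  rewrite mxE; case: splitP => k hk; last first.
    by rewrite mxE (_ : s == 0 = false) ?mul0r // -val_eqE /= hk.
  rewrite (_ : s == 0) ?mul1r -?colE ?mxE ?ord1 //.
  by rewrite -val_eqE /= hk ord1.
have := congr1 (fun v : 'rV_M.+1 => v 0 r) (mulmxA phi D (\adj D)).
rewrite mul_mx_adj mul_mx_scalar [LHS]mxE [RHS]mxE (bigD1 0) //=.
rewrite big1 => [|s /negPf s0]; last by rewrite phiD s0 !mul0r.
rewrite phiD mul1r addr0 mxE cofD detD => e.
by rewrite (mulrC (phi 0 r)) e mulrCA signrMK.
Qed.

(** In a domain the proportionality above determines all the maximal minors
    from one of them.  The number of rows is kept as a variable [p] because
    the intended matrix has a size that is not syntactically a successor. *)
Lemma minors_ideal_left_kernel (R : idomainType) p (C : 'M[R]_(p, p.-1))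
    (phi : nat -> R) (a : R) (r0 : 'I_p) : r0 = 0 :> nat ->
  (forall t, \sum_(r < p) phi r * C r t = 0) -> phi 0 != 0 ->
  \det (row' r0 C) = a * phi 0 -> forall q,
  minors_ideal p.-1 C q <-> exists c : 'I_p -> R, q = a * \sum_(r < p) c r * phi r.
Proof.
case: p C r0 => [|M] C r0 /= r00 hC phi0 h0 q; first by case: r0 r00 h0.
have {r00}er : r0 = 0 by exact: val_inj.
rewrite {}er {r0} in h0.
pose v : 'rV[R]_M.+1 := \row_r phi r.
have hv : v *m C = 0.
  by apply/rowP => t; rewrite !mxE -[RHS](hC t); apply: eq_bigr => r _; rewrite mxE.
have E r : \det (row' r C) = (-1) ^+ r * (a * phi r).
  have := det_row'_left_kernel r hv; rewrite !mxE h0 => e.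
  by apply: (mulfI phi0); rewrite e; ring.
rewrite minors_ideal_row'; split=> -[c ->].
  exists (fun r : 'I_M.+1 => (-1) ^+ r * c r); rewrite [RHS]mulr_sumr.
  by apply: eq_bigr => r _; rewrite E; ring.
exists (fun r : 'I_M.+1 => (-1) ^+ r * c r); rewrite [LHS]mulr_sumr.
by apply: eq_bigr => r _; rewrite E mulrACA -signr_odd -expr2 sqrr_sign; ring.
Qed.

(** * Variables are regular modulo one another *)

Section RegularVariables.
Variables (K : fieldType) (n : nat).
Local Notation S := {mpoly K[n]}.
Implicit Types (k : 'I_n) (p : S).

(** The substitution x_k := 0, that is, reduction modulo x_k followed by the
    obvious section; its target being a domain is what shows that x_k is
    prime. *)
Definition kill_var k p : S :=
  p \mPo [tuple (if i == k then 0 else 'X_i : S) | i < n].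

Lemma kill_varX k i : kill_var k 'X_i = if i == k then 0 else 'X_i.
Proof. by rewrite /kill_var comp_mpolyXU -tnth_nth tnth_mktuple. Qed.

Lemma kill_varP k p : exists q, p = 'X_k * q + kill_var k p.
Proof.
pose P (q : S) := exists r, q = 'X_k * r + kill_var k q.
have PD q r : P q -> P r -> P (q + r).
  move=> [a ea] [b eb]; exists (a + b).
  by rewrite {1}ea {1}eb /kill_var comp_mpolyD; ring.
have PM q r : P q -> P r -> P (q * r).
  move=> [a ea] [b eb].
  exists (a * ('X_k * b + kill_var k r) + kill_var k q * b).
  by rewrite {1}ea {1}eb /kill_var rmorphM /=; ring.
have PC c : P c%:MP by exists 0; rewrite /kill_var comp_mpolyC; ring.
have PX i : P 'X_i.
  rewrite /P kill_varX; case: eqP => [->|_]; first by exists 1; ring.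
  by exists 0; ring.
rewrite -/(P p) (mpolyE p); apply: (big_ind P) => [|//|m _].
  by rewrite -[0]/(0%:MP); exact: PC.
rewrite -mul_mpolyC; apply: (PM) => //; rewrite mpolyXE_id.
apply: (big_ind P) => [|//|i _]; first exact: (PC 1).
by elim: (m i) => [|e IH]; [exact: (PC 1) | rewrite exprS; exact: PM].
Qed.

(** If x_k divides a y, then the images of a and y under x_k := 0 have
    product zero, so y maps to zero, which makes it a multiple of x_k by
    [kill_varP]. *)
Lemma regular_mod_X k (a : S) : kill_var k a != 0 -> regular_mod 'X_k a.
Proof.
move=> ha y [c hc]; have [q hq] := kill_varP k y.
have := congr1 (kill_var k) hc; rewrite {1 2}/kill_var !rmorphM /=.
rewrite -!/(kill_var k _) kill_varX eqxx mul0r => /eqP.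
rewrite mulf_eq0 (negPf ha) /= => /eqP y0.
by exists q; rewrite {1}hq y0 addr0.
Qed.

Lemma mpolyX1_neq0 (i : 'I_n) : 'X_i != 0 :> S.
Proof.
apply/eqP => /(congr1 (meval (fun=> 1))); rewrite mevalXU meval0 => /eqP.
by rewrite oner_eq0.
Qed.

Lemma mpolyX_add_neq0 (i j : 'I_n) : i != j -> 'X_i + 'X_j != 0 :> S.
Proof.
move=> ij; apply/eqP => /(congr1 (meval (fun l => (l == i)%:R))).
rewrite mevalD !mevalXU meval0 eqxx eq_sym (negPf ij) addr0 => /eqP.
by rewrite oner_eq0.
Qed.
End RegularVariables.

(** * The Koszul differential in degrees two and three *)

Section Koszul.
Variables (K : fieldType).

Lemma kdiff_kbasis n j (A : {set 'I_n}) : #|A| == j ->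
  kdiff (kbasis K j A) = kdiff_basis K j A.
Proof.
move=> hA; rewrite /kdiff (bigD1 (Sub A hA : ksub n j)) //= ffunE eqxx scale1r.
rewrite big1 ?addr0 // => B; rewrite -val_eqE ffunE /= => /negPf->.
by rewrite scale0r.
Qed.

Lemma kdiff_kbasis2 n (x y : 'I_n) : (x < y)%N ->
  kdiff (kbasis K 2 [set x; y])
    = ('X_x : {mpoly K[n]}) *: kbasis K 1 [set y]
      - ('X_y : {mpoly K[n]}) *: kbasis K 1 [set x].
Proof.
move=> xy; have xNy : x != y by rewrite -val_eqE /= neq_ltn xy.
rewrite kdiff_kbasis ?cards2 ?xNy // /kdiff_basis.
rewrite big_setU1 ?inE //= big_set1.
have -> : [set b in [set x; y] | (b < x)%N] = set0.
  by apply/setP => b; rewrite !inE; case: eqP => [->|_]; case: eqP => [->|_] /=; lia.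
have -> : [set b in [set x; y] | (b < y)%N] = [set x].
  apply/setP => b; rewrite !inE; case: eqP => [->|_] //=.
  by case: eqP => [->|_] /=; lia.
rewrite cards0.
rewrite cards1.
rewrite expr0 expr1.
rewrite mul1r.
rewrite mulN1r.
rewrite (@scaleNr {mpoly K[n]}).
have -> : [set x; y] :\ x = [set y] by rewrite setU1K ?inE.
have -> : [set x; y] :\ y = [set x] by rewrite setUC setU1K // inE eq_sym.
by [].
Qed.

Lemma kdiff_kbasis3 n (x y z : 'I_n) : (x < y < z)%N ->
  kdiff (kbasis K 3 [set x; y; z])
    = ('X_x : {mpoly K[n]}) *: kbasis K 2 [set y; z]
      - ('X_y : {mpoly K[n]}) *: kbasis K 2 [set x; z]
      + ('X_z : {mpoly K[n]}) *: kbasis K 2 [set x; y].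
Proof.
move=> /andP[xy yz]; have xz := ltn_trans xy yz.
have xNy : x == y = false by rewrite -val_eqE /= ltn_eqF.
have yNz : y == z = false by rewrite -val_eqE /= ltn_eqF.
have xNz : x == z = false by rewrite -val_eqE /= ltn_eqF.
have NE := (xNy, yNz, xNz, eq_sym y x, eq_sym z x, eq_sym z y).
have eA : [set x; y; z] = x |: (y |: [set z]) by rewrite -setUA.
have xA : x \notin y |: [set z] by rewrite !inE !NE.
have yA : y \notin [set z] by rewrite !inE !NE.
have c3 : #|[set x; y; z]| == 3 by rewrite eA !cardsU1 xA yA cards1.
rewrite (kdiff_kbasis c3) /kdiff_basis eA big_setU1 //= big_setU1 //= big_set1.
have -> : [set b in x |: (y |: [set z]) | (b < x)%N] = set0.
  apply/setP => b; rewrite !inE; apply/negP => /andP[+ bx].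
  by case/or3P => /eqP eb; move: bx; rewrite eb; lia.
have -> : [set b in x |: (y |: [set z]) | (b < y)%N] = [set x].
  apply/setP => b; rewrite !inE; apply/andP/eqP => [[+ by_]|->].
    by case/or3P => /eqP eb //; move: by_; rewrite eb; lia.
  by rewrite eqxx.
have -> : [set b in x |: (y |: [set z]) | (b < z)%N] = [set x; y].
  apply/setP => b; rewrite !inE; apply/andP/orP => [[+ bz]|[] /eqP->].
  - by case/or3P => /eqP eb; rewrite ?eb ?eqxx; [left|right|move: bz; rewrite eb; lia].
  - by rewrite eqxx.
  - by rewrite eqxx orbT.
have -> : (x |: (y |: [set z])) :\ x = [set y; z] by rewrite setU1K.
have -> : (x |: (y |: [set z])) :\ y = [set x; z].
  by apply/setP => b; rewrite !inE; case: (eqVneq b y) => [->|] //=; rewrite !NE.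
have -> : (x |: (y |: [set z])) :\ z = [set x; y].
  apply/setP => b; rewrite !inE; case: (eqVneq b z) => [->|] /=; rewrite ?NE //.
  by rewrite orbF.
rewrite cards0 cards1 cards2 xNy expr0 expr1 mul1r mulN1r sqrrN expr1n mul1r.
by rewrite (@scaleNr {mpoly K[n]}) addrA.
Qed.

End Koszul.

(** * The functional on the second syzygies *)

Section Bourbaki.
Variables (K : fieldType) (L : nat).
Local Notation n := L.+3.
Local Notation S := {mpoly K[n]}.

(** In this section variables and basis vectors are indexed by natural
    numbers starting from 0.  The operations below are locked: unfolding them
    reaches the representation of polynomials and finite functions, on which
    a failing comparison of two terms is very expensive. *)
Definition var : nat -> S := locked (fun j => 'X_(inord j)).

Lemma varE j : var j = 'X_(inord j).
Proof. by rewrite /var -lock. Qed.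

Lemma sing_subproof (j : nat) : #|[set inord j : 'I_n]| == 1.
Proof. by rewrite cards1. Qed.

Definition sing (j : nat) : ksub n 1 := Sub [set inord j] (sing_subproof j).

Lemma sing_ord (A : ksub n 1) : exists2 j, (j < n)%N & A = sing j.
Proof.
have /cards1P[x ex] := valP A; exists x => //.
by apply: val_inj; rewrite /= inord_val.
Qed.

Lemma inord_eq j k : (j < n)%N -> (k < n)%N ->
  (inord j == inord k :> 'I_n) = (j == k).
Proof. by move=> hj hk; rewrite -val_eqE /= !inordK. Qed.

Lemma inord_lt j k : (j < n)%N -> (k < n)%N ->
  ((inord j : 'I_n) < (inord k : 'I_n))%N = (j < k)%N.
Proof. by move=> hj hk; rewrite !inordK. Qed.

Lemma kidxE (s : seq nat) : all (fun j => j < n)%N s ->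
  kidx n [seq j.+1 | j <- s] = [set i in [seq inord j | j <- s]].
Proof.
move=> hs; apply/setP => i; rewrite !inE; apply/mapP/mapP => -[j js e].
  by exists j => //; apply: val_inj; case: e => /= ->; rewrite inordK // (allP hs).
by exists j => //; rewrite e inordK // (allP hs).
Qed.

Definition e2 : nat -> nat -> koszul K n 2 :=
  locked (fun i j => ke2 K n (i.+1, j.+1)).

Lemma e2E i j : e2 i j = ke2 K n (i.+1, j.+1).
Proof. by rewrite /e2 -lock. Qed.

Lemma ke2E i j : (i < n)%N -> (j < n)%N ->
  ke2 K n (i.+1, j.+1) = kbasis K 2 [set inord i; inord j].
Proof.
move=> hi hj; rewrite /ke2 /ke; congr kbasis.
rewrite -[[:: _; _]]/(map succn [:: i; j]) kidxE /= ?hi ?hj //.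
by apply/setP => k; rewrite !inE.
Qed.

Lemma ke3E i j k : (i < n)%N -> (j < n)%N -> (k < n)%N ->
  ke3 K n (i.+1, j.+1, k.+1) = kbasis K 3 [set inord i; inord j; inord k].
Proof.
move=> hi hj hk; rewrite /ke3 /ke; congr kbasis.
rewrite -[[:: _; _; _]]/(map succn [:: i; j; k]) kidxE /= ?hi ?hj ?hk //.
by apply/setP => l; rewrite !inE orbA.
Qed.

Lemma kdiff_ke3 i j k : (i < j < k)%N -> (k < n)%N ->
  kdiff (ke3 K n (i.+1, j.+1, k.+1)) =
    var i *: e2 j k - var j *: e2 i k
      + var k *: e2 i j.
Proof.
move=> ijk hk; have hj : (j < n)%N by lia.
have hi : (i < n)%N by lia.
by rewrite ke3E // kdiff_kbasis3 ?e2E ?ke2E ?varE // !inord_lt.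
Qed.

Definition coord1 : koszul K n 1 -> nat -> S := locked (fun z j => z (sing j)).

Lemma coord1E z j : coord1 z j = z (sing j).
Proof. by rewrite /coord1 -lock. Qed.

Lemma coord1_linear a u v j :
  coord1 (a *: u + v) j = a * coord1 u j + coord1 v j.
Proof. by rewrite !coord1E !ffunE. Qed.

Lemma coord1_0 j : coord1 0 j = 0.
Proof. by rewrite coord1E ffunE. Qed.

Lemma coord1_sum (c : nat -> S) (u : nat -> koszul K n 1) m j :
  coord1 (\sum_(i < m) c i *: u i) j = \sum_(i < m) c i * coord1 (u i) j.
Proof.
elim: m => [|m IH]; first by rewrite !big_ord0 coord1_0.
by rewrite !big_ord_recr /= addrC coord1_linear IH addrC.
Qed.

Lemma coord1_inj z z' :
  (forall j, (j < n)%N -> coord1 z j = coord1 z' j) -> z = z'.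
Proof.
move=> h; apply/ffunP => A; have [j hj ->] := sing_ord A.
by have := h j hj; rewrite !coord1E.
Qed.

Definition bdry : koszul K n 2 -> koszul K n 1 := locked (fun u => kdiff u).

Lemma bdryE u : bdry u = kdiff u.
Proof. by rewrite /bdry -lock. Qed.

Lemma bdry_linear a u v : bdry (a *: u + v) = a *: bdry u + bdry v.
Proof. rewrite !bdryE; exact: (@kdiff_is_linear K n 2 a u v). Qed.

Lemma bdry0 : bdry 0 = 0.
Proof. by rewrite bdryE linear0. Qed.

Lemma bdry_sum (c : nat -> S) (u : nat -> koszul K n 2) m :
  bdry (\sum_(i < m) c i *: u i) = \sum_(i < m) c i *: bdry (u i).
Proof.
elim: m => [|m IH]; first by rewrite !big_ord0 bdry0.
by rewrite !big_ord_recr /= addrC bdry_linear IH addrC.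
Qed.

Lemma coord1_bdry_ke2 i j k : (i < j < n)%N -> (k < n)%N ->
  coord1 (bdry (e2 i j)) k
    = var i * (k == j)%:R - var j * (k == i)%:R.
Proof.
move=> /andP[ij hj] hk; have hi := ltn_trans ij hj.
rewrite bdryE e2E ke2E // kdiff_kbasis2 ?inord_lt // !varE coord1E !ffunE /=.
by rewrite !(inj_eq set1_inj) !inord_eq.
Qed.

Lemma koszul2_indn (P : koszul K n 2 -> Prop) : P 0 ->
  (forall a u v, P u -> P v -> P (a *: u + v)) ->
  (forall i j, (i < j < n)%N -> P (e2 i j)) -> forall u, P u.
Proof.
move=> P0 PD Pe; apply: koszul2_ind => // -[[|i] [|j]]; rewrite /vpair ?andbF //=.
by move=> hij; rewrite -e2E; exact: Pe.
Qed.

Definition dotp : (nat -> S) -> koszul K n 1 -> S :=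
  locked (fun y z => \sum_(j < n) y j * coord1 z j).

Lemma dotpE y z : dotp y z = \sum_(j < n) y j * coord1 z j.
Proof. by rewrite /dotp -lock. Qed.

Lemma dotp_linear y a u v : dotp y (a *: u + v) = a * dotp y u + dotp y v.
Proof.
rewrite !dotpE mulr_sumr -big_split; apply: eq_bigr => j _.
by rewrite coord1_linear /=; ring.
Qed.

Lemma dotp0 y : dotp y 0 = 0.
Proof. by rewrite dotpE big1 // => j _; rewrite coord1_0 mulr0. Qed.

Lemma sum_pick (F : nat -> S) j : (j < n)%N ->
  \sum_(k < n) F k * ((k : nat) == j)%:R = F j.
Proof.
move=> hj; rewrite (bigD1 (Ordinal hj)) //= eqxx mulr1 big1 ?addr0 // => k.
by rewrite -val_eqE /= => /negPf->; rewrite mulr0.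
Qed.

Lemma dotp_ke2 y i j : (i < j < n)%N ->
  dotp y (bdry (e2 i j)) = var i * y j - var j * y i.
Proof.
move=> hij; have [hi hj] : (i < n)%N /\ (j < n)%N by lia.
rewrite dotpE -(sum_pick y hi) -(sum_pick y hj) !mulr_sumr -sumrB.
apply: eq_bigr => k _; rewrite coord1_bdry_ke2 //; ring.
Qed.

(** This is the vanishing of the composite of the two Koszul differentials
    K_2 -> K_1 -> K_0. *)
Lemma dotp_var_bdry u : dotp var (bdry u) = 0.
Proof.
elim/koszul2_indn: u => [|a u v hu hv|i j hij].
- by rewrite bdry0 dotp0.
- by rewrite bdry_linear dotp_linear hu hv mulr0 addr0.
by rewrite dotp_ke2 // mulrC subrr.
Qed.

(** The composite of K_2 -> Z_2 with the functional attached to [wsol]. *)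
Definition wform : koszul K n 2 -> S :=
  locked (fun u => dotp (wsol L var) (bdry u)).

Lemma wformE u : wform u = dotp (wsol L var) (bdry u).
Proof. by rewrite /wform -lock. Qed.

Lemma wform_linear a u v : wform (a *: u + v) = a * wform u + wform v.
Proof. by rewrite !wformE bdry_linear dotp_linear. Qed.

Lemma wform0 : wform 0 = 0.
Proof. by rewrite !wformE bdry0 dotp0. Qed.

Lemma wformZ a u : wform (a *: u) = a * wform u.
Proof. by rewrite -[_ *: _]addr0 wform_linear wform0 addr0. Qed.

Lemma wformD u v : wform (u + v) = wform u + wform v.
Proof. by rewrite -[u]scale1r wform_linear mul1r scale1r. Qed.

Lemma wformB u v : wform (u - v) = wform u - wform v.
Proof. by rewrite wformD -scaleN1r wformZ mulN1r. Qed.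

Lemma wform_comb3 a b c u v w :
  wform (a *: u - b *: v + c *: w) = a * wform u - b * wform v + c * wform w.
Proof. by rewrite wformD wformB 3!wformZ. Qed.

Lemma wform_sum (I : Type) (s : seq I) (c : I -> S) (u : I -> koszul K n 2) :
  wform (\sum_(i <- s) c i *: u i) = \sum_(i <- s) c i * wform (u i).
Proof.
by elim: s => [|i s IH]; rewrite ?big_nil ?wform0 // !big_cons wform_linear IH.
Qed.

Lemma wform_ke2 i j : (i < j < n)%N ->
  wform (e2 i j) = var i * wsol L var j - var j * wsol L var i.
Proof. by move=> hij; rewrite wformE dotp_ke2. Qed.

Lemma wform_consec i : (i < L.+2)%N ->
  wform (e2 i i.+1) = \prod_(1 <= k < L.+2) var k.
Proof. by move=> hi; rewrite wform_ke2 ?wsol_wronskian //; lia. Qed.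

(** The Pluecker-type identity
    x_i phi_{jk} - x_j phi_{ik} + x_k phi_{ij} = 0 for the Wronskians
    phi_{ij} = x_i g_j - x_j g_i. *)
Lemma wform_kdiff_ke3 i j k : (i < j < k)%N -> (k < n)%N ->
  wform (kdiff (ke3 K n (i.+1, j.+1, k.+1))) = 0.
Proof.
move=> /andP[ij jk] hk; have ik := ltn_trans ij jk.
rewrite kdiff_ke3 ?ij // wform_comb3.
rewrite (wform_ke2 (i := j)) ?jk // (wform_ke2 (j := k)) ?ik //.
rewrite (wform_ke2 (j := j)) ?ij ?(ltn_trans jk) //; ring.
Qed.

Definition fgen (i : nat) : koszul K n 2 :=
  e2 i i.+1 - e2 i.+1 i.+2.

Lemma wform_fgen i : (i < L.+1)%N -> wform (fgen i) = 0.
Proof. by move=> hi; rewrite wformB !wform_consec ?subrr //; lia. Qed.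

Lemma wform_inF u : inF u -> wform u = 0.
Proof.
move=> [c ->]; rewrite wform_sum big1_seq // => -[|i]; rewrite mem_index_iota //=.
by move=> hi; rewrite -!e2E -/(fgen i) wform_fgen ?mulr0 //; lia.
Qed.

Lemma coord1_bdry_fgen i k : (i < L.+1)%N -> (k < n)%N ->
  coord1 (bdry (fgen i)) k = trid var i k.
Proof.
move=> hi hk; rewrite /fgen addrC -scaleN1r bdry_linear coord1_linear.
rewrite !coord1_bdry_ke2; try lia.
rewrite /trid; have [->|_] := eqVneq k i; last by rewrite /=; ring.
have -> : (i == i.+1) = false by lia.
have -> : (i == i.+2) = false by lia.
by rewrite /=; ring.
Qed.

Definition relF (c : nat -> S) : koszul K n 2 := \sum_(i < L.+1) c i *: fgen i.

Lemma coord1_relF c k : (k < n)%N ->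
  coord1 (bdry (relF c)) k = \sum_(i < L.+1) c i * trid var i k.
Proof.
move=> hk; rewrite /relF bdry_sum (coord1_sum c (fun i => bdry (fgen i))).
by apply: eq_bigr => i _; rewrite coord1_bdry_fgen.
Qed.

Lemma var_neq0 j : var j != 0.
Proof. by rewrite varE mpolyX1_neq0. Qed.

Lemma regular_var i j : (i < n)%N -> (j < n)%N -> i != j ->
  regular_mod (var i) (var j).
Proof.
move=> hi hj ij; rewrite !varE; apply: regular_mod_X.
by rewrite kill_varX (inord_eq hj hi) (eq_sym j) (negPf ij) mpolyX1_neq0.
Qed.

Lemma regular_varD k : (k < L.+1)%N ->
  regular_mod (var k.+1) (var k + var k.+2).
Proof.
move=> hk; rewrite !varE; apply: regular_mod_X; rewrite /kill_var comp_mpolyD.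
rewrite -!/(kill_var _ _) !kill_varX !inord_eq; try lia.
have -> : (k == k.+1) = false by lia.
have -> : (k.+2 == k.+1) = false by lia.
by apply: mpolyX_add_neq0; rewrite inord_eq; lia.
Qed.

(** This is [trid_exact] for the variables themselves.  Its hypotheses hold
    over any field: a variable is regular modulo another one, and so is
    x_k + x_{k+2} modulo x_{k+1}, as x_k and x_{k+2} are distinct. *)
Lemma wform_eq0 u : wform u = 0 -> exists c : nat -> S, bdry u = bdry (relF c).
Proof.
move=> hu.
have [|||||c hc] := @trid_exact _ L var (coord1 (bdry u)).
- by move=> k _; exact: var_neq0.
- exact: regular_varD.
- by move=> i k hik hk; apply: regular_var; lia.
- by rewrite -dotpE dotp_var_bdry.
- by rewrite -dotpE -wformE.
by exists c; apply: coord1_inj => j hj; rewrite hc // coord1_relF.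
Qed.

Lemma bdry_relF_inj c : bdry (relF c) = 0 -> forall i, (i < L.+1)%N -> c i = 0.
Proof.
move=> h; apply: (@trid_free _ L.+1 var) => [k _|j hj]; first exact: var_neq0.
by rewrite -coord1_relF ?h ?coord1_0 //; lia.
Qed.

(** * The determinants of the presentation matrix *)

(** Columns and the rows other than e_{12} are enumerated in parallel: the
    column e_{i,i+1,k} sits opposite the row e_{i,k}.  This places the
    coefficients - x_{i+1} on the diagonal. *)
Lemma Ccols_map :
  Ccols n = [seq (p.1, p.1.+1, p.2) | p <- behead (Crows n)].
Proof.
exact: esym (@map_allpairs nat (fun=> nat) _ (nat * nat)%type
  (fun p => (p.1, p.1.+1, p.2)) (fun i k => (i, k)) _ _).
Qed.

Lemma behead_CrowsP p : p \in behead (Crows n) ->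
  exists i k, p = (i.+1, k.+1) /\ (i.+1 < k < n)%N.
Proof.
case/allpairsPdep=> -[|i] [[|k]] [+ + ->]; rewrite !mem_iota; try lia.
by move=> hi hk; exists i, k; split=> //; lia.
Qed.

Lemma allpairs_fst_sorted (f : nat -> seq nat) a m :
  pairwise (fun p q : nat * nat => (p.1 <= q.1)%N)
    [seq (i, k) | i <- iota a m, k <- f i].
Proof.
elim: m a => [|m IH] a //.
rewrite (_ : [seq (i, k) | i <- iota a m.+1, k <- f i]
  = [seq (a, k) | k <- f a]
    ++ [seq (i, k) | i <- iota a.+1 m, k <- f i]) // pairwise_cat IH andbT.
apply/andP; split.
  apply/allrelP => p q /mapP[k _ ->] /allpairsPdep[i [l [+ _ ->]]].
  by rewrite mem_iota /=; lia.
by rewrite pairwise_map; elim: (f a) => //= k s ->; rewrite andbT; apply/allP => l _ /=.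
Qed.

(** A column e_{i,i+1,k} also meets the row e_{i+1,k}, which has a larger
    first index; the ordering of the rows by first index puts that entry below
    the diagonal. *)
Lemma behead_Crows_sorted :
  pairwise (fun p q : nat * nat => (p.1 <= q.1)%N) (behead (Crows n)).
Proof. exact: allpairs_fst_sorted. Qed.

Definition crow t : nat * nat := nth (0, 0)%N (Crows n) t.

Lemma crow0 : crow 0 = (1, 2)%N. Proof. by []. Qed.

Lemma size_behead_Crows : size (behead (Crows n)) = (rankN n).-1.
Proof. by rewrite size_behead size_Crows. Qed.

Lemma crow_mem t : (t < (rankN n).-1)%N -> crow t.+1 \in behead (Crows n).
Proof.
move=> ht; rewrite -[crow _]/(nth (0, 0)%N (behead (Crows n)) t).
by rewrite mem_nth ?size_behead_Crows.
Qed.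

Lemma crow_succ t : (t < (rankN n).-1)%N ->
  exists i k, crow t.+1 = (i.+1, k.+1) /\ (i.+1 < k < n)%N.
Proof. by move/crow_mem/behead_CrowsP. Qed.

Lemma crow_inH t : (t < rankN n)%N -> inH n (crow t).
Proof. by move=> ht; rewrite -mem_Crows // mem_nth // size_Crows. Qed.

Lemma crow_inj s t : (s < rankN n)%N -> (t < rankN n)%N ->
  (crow s == crow t) = (s == t).
Proof. by move=> hs ht; rewrite nth_uniq ?size_Crows ?Crows_uniq. Qed.

Lemma crow_mono s t : (s < t < (rankN n).-1)%N ->
  ((crow s.+1).1 <= (crow t.+1).1)%N.
Proof.
move=> /andP[st ht]; have /(pairwiseP (0, 0)%N) := behead_Crows_sorted.
by apply=> //; rewrite inE size_behead_Crows //; lia.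
Qed.

Lemma Ccols_nth t : (t < (rankN n).-1)%N ->
  nth (0, 0, 0)%N (Ccols n) t = ((crow t.+1).1, (crow t.+1).1.+1, (crow t.+1).2).
Proof.
by move=> ht; rewrite Ccols_map (nth_map (0, 0)%N) ?size_behead_Crows.
Qed.

Lemma coordF_comb3 (a b c : S) (u v w : koszul K n 2) p :
  coordF (a *: u - b *: v + c *: w) p
    = a * coordF u p - b * coordF v p + c * coordF w p.
Proof.
rewrite coordFD (coordFZ c w) -scaleNr coordFD (coordFZ a u) (coordFZ (- b) v).
by rewrite mulNr.
Qed.

(** Away from the class of e_{12}, into which all the e_{i,i+1} are
    collapsed, the coordinates modulo F are those of K_2. *)
Lemma coordF_e2 i j h : (i < j < n)%N -> inH n h -> h != (1, 2)%N ->
  coordF (e2 i j) h = (h == (i.+1, j.+1))%:R.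
Proof.
move=> hij hh h12; rewrite /coordF (negPf h12) e2E kcf_ke2 //.
exact: H_vpair.
Qed.

Section Matrix.
Variables (C : 'M[S]_(rankN n, (rankN n).-1)) (hC : is_C C).

Lemma C_coordF (r : 'I_(rankN n)) t :
  C r t = coordF (kdiff (ke3 K n (nth (0, 0, 0)%N (Ccols n) t))) (crow r).
Proof.
have e s : coordF (C s t *: ke2 K n (crow s)) (crow r) = C s t * (r == s)%:R.
  by rewrite coordFZ coordF_basis ?crow_inH // crow_inj.
have e' : coordF (\sum_(s < rankN n) C s t *: ke2 K n (crow s)) (crow r) = C r t.
  rewrite coordF_sum; transitivity (\sum_(s < rankN n) C s t * (r == s)%:R).
    by apply: eq_bigr => s _; exact: e.
  rewrite (bigD1 r) //= eqxx mulr1 big1 ?addr0 // => s.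
  by rewrite eq_sym => /negPf->; rewrite mulr0.
have := @coordF_inF K n _ _ isT (crow_inH (ltn_ord r)) (hC t).
rewrite -[- _]scaleN1r coordFD coordFZ e' mulN1r => /eqP.
by rewrite subr_eq0 => /eqP.
Qed.

Lemma C_entry (r : 'I_(rankN n)) (t : 'I_(rankN n).-1) i k :
  crow t.+1 = (i.+1, k.+1) -> (i.+1 < k < n)%N -> (0 < r)%N ->
  C r t = var i * (crow r == (i.+2, k.+1))%:R
          - var i.+1 * (crow r == (i.+1, k.+1))%:R.
Proof.
case: r => -[|r] hr // et ik _; rewrite C_coordF Ccols_nth // et /=.
have hH : inH n (crow r.+1) by exact: crow_inH.
have hr0 : crow r.+1 != (1, 2)%N by rewrite -crow0 crow_inj //; exact: leq_trans hr.
have [j [l [er jl]]] : exists j l, crow r.+1 = (j.+1, l.+1) /\ (j.+1 < l < n)%N.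
  by apply: crow_succ; lia.
rewrite kdiff_ke3; try lia.
rewrite coordF_comb3 (@coordF_e2 i.+1 k) // (@coordF_e2 i k)
  ?(@coordF_e2 i i.+1) //; try lia.
have -> : (crow r.+1 == (i.+1, i.+2)) = false by rewrite er xpair_eqE; lia.
by rewrite mulr0 addr0.
Qed.

Lemma wform_kernel t : \sum_(r < rankN n) wform (ke2 K n (crow r)) * C r t = 0.
Proof.
have [i [k [et ik]]] := crow_succ (ltn_ord t).
have := wform_inF (hC t).
rewrite wformB Ccols_nth // et /= wform_kdiff_ke3; try lia.
rewrite wform_sum sub0r => /eqP; rewrite oppr_eq0 => /eqP e.
by rewrite -[RHS]e; apply: eq_bigr => r _; rewrite mulrC.
Qed.

Lemma det_row'0 (r0 : 'I_(rankN n)) : r0 = 0 :> nat ->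
  \det (row' r0 C) = \prod_(t < (rankN n).-1) - var (crow t.+1).1.
Proof.
move=> r00; have lift0E (r : 'I_(rankN n).-1) : lift r0 r = r.+1 :> nat.
  by rewrite /= r00.
have rlt (r : 'I_(rankN n).-1) : (r.+1 < rankN n)%N.
  by have := ltn_ord r; lia.
rewrite det_trig.
  apply: eq_bigr => t _; have [i [k [et ik]]] := crow_succ (ltn_ord t).
  rewrite mxE (C_entry et ik) lift0E // et eqxx mulr1 xpair_eqE.
  by rewrite (_ : i.+1 == i.+2 = false) ?mulr0 ?sub0r //; lia.
apply/is_trig_mxP => r t rt; have [i [k [et ik]]] := crow_succ (ltn_ord t).
rewrite mxE (C_entry et ik) lift0E //.
have := @crow_mono r t; rewrite rt ltn_ord et => /(_ isT) /= hle.
have -> : (crow r.+1 == (i.+2, k.+1)) = false.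
  by case: (crow _) hle => a b /= hle; rewrite xpair_eqE; lia.
by rewrite -et crow_inj ?rlt // eqSS ltn_eqF // !mulr0 subrr.
Qed.
End Matrix.

Lemma bourbaki_factorE :
  bourbaki_factor K n = \prod_(1 <= i < L.+1) var i ^+ (L.+1 - i).
Proof.
rewrite /bourbaki_factor.
transitivity (\prod_(i < n | (2 <= i.+1 <= n - 2)%N) var i ^+ (n - 1 - i.+1)).
  by apply: eq_bigr => i _; rewrite varE inord_val.
rewrite -(big_mkord (fun i => 2 <= i.+1 <= n - 2)%N (fun i => var i ^+ (n - 1 - i.+1))).
rewrite [RHS](big_nat_widenl 1 0) // [RHS](big_nat_widen 0 L.+1 n); last by lia.
rewrite big_nat_cond [RHS]big_nat_cond; apply: eq_big => i; first by lia.
by move=> hi; congr (_ ^+ _); lia.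
Qed.

(** The variable x_i occurs once for each k with (i, k) indexing a row, that
    is n - 1 - i times in the numbering from 0: one more than its exponent in
    the factor a, the missing ones forming the product w. *)
Lemma prod_crow_var :
  \prod_(t < (rankN n).-1) var (crow t.+1).1
    = bourbaki_factor K n * \prod_(1 <= k < L.+2) var k.
Proof.
transitivity (\prod_(p <- behead (Crows n)) var p.1).
  by rewrite (big_nth (0, 0)%N) size_behead_Crows big_mkord.
transitivity (\prod_(i <- iota 1 (n - 2)) \prod_(k <- iota i.+2 (n - i.+1)) var i).
  exact: (@big_allpairs_dep _ _ _ _ (fun=> nat) _ (fun i k => (i, k)) _ _
    (fun p => var p.1)).
transitivity (\prod_(1 <= i < L.+2) var i ^+ (L.+2 - i)).
  rewrite /index_iota; apply: eq_big_seq => i; rewrite mem_iota => hi.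
  rewrite (eq_bigr (fun=> var i)) // big_const_seq count_predT size_iota.
  by rewrite iter_mulr_1; congr (_ ^+ _); lia.
have -> : bourbaki_factor K n = \prod_(1 <= i < L.+2) var i ^+ (L.+1 - i).
  by rewrite bourbaki_factorE [RHS]big_nat_recr //= subnn mulr1.
rewrite -big_split; apply: eq_big_nat => i hi /=.
by rewrite -exprSr; congr (_ ^+ _); lia.
Qed.

Lemma bourbaki_factor_neq0 : bourbaki_factor K n != 0.
Proof.
rewrite bourbaki_factorE prodf_seq_neq0; apply/allP => i _.
by rewrite expf_neq0 ?var_neq0.
Qed.

Lemma wform_crow0 : wform (ke2 K n (crow 0)) = \prod_(1 <= k < L.+2) var k.
Proof. by rewrite crow0 -e2E wform_consec. Qed.

Lemma wform_crow0_neq0 : wform (ke2 K n (crow 0)) != 0.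
Proof.
by rewrite wform_crow0 prodf_seq_neq0; apply/allP => i _; rewrite var_neq0.
Qed.

(** The functional vanishes on F, so it only depends on the class in
    K_2 / F. *)
Lemma wform_coordF u :
  wform u = \sum_(r < rankN n) coordF u (crow r) * wform (ke2 K n (crow r)).
Proof.
have := wform_inF (modF_span u isT); rewrite wformB => /eqP.
rewrite subr_eq0 => /eqP ->.
by rewrite (sum_Crows (fun h => coordF u h *: ke2 K n h)) // wform_sum.
Qed.

(** The sign of the triangular determinant is absorbed into the
    coefficients of the combination. *)
Lemma minors_idealP (C : 'M[S]_(rankN n, (rankN n).-1)) : is_C C -> forall q,
  minors_ideal (rankN n).-1 C q <->
  exists u, q = bourbaki_factor K n * wform u.
Proof.
move=> hC q; have N0 : (0 < rankN n)%N by rewrite bin2_pred.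
pose r0 := Ordinal N0.
have hd : \det (row' r0 C) = (-1) ^+ (rankN n).-1 * bourbaki_factor K n
    * wform (ke2 K n (crow 0)).
  rewrite (det_row'0 hC) // -mulrA wform_crow0 -prod_crow_var.
  by rewrite prodrN card_ord.
have := @minors_ideal_left_kernel _ _ C (fun r => wform (ke2 K n (crow r))) _ r0
  erefl (wform_kernel hC) wform_crow0_neq0 hd q.
move=> ->; split=> [[c ->]|[u ->]].
  exists ((-1) ^+ (rankN n).-1 *: \sum_(r < rankN n) c r *: ke2 K n (crow r)).
  by rewrite wformZ wform_sum mulrA; congr (_ * _); rewrite mulrC.
exists (fun r => (-1) ^+ (rankN n).-1 * coordF u (crow r)).
under eq_bigr do rewrite -mulrA.
by rewrite -mulr_sumr -wform_coordF mulrACA -expr2 sqrr_sign mul1r.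
Qed.

(** * The exact sequence *)

Definition to_Z2 : koszul K n 2 -> Z2 K n := locked (fun u =>
  Sub (kdiff u) (introT (im_predP (@kdiff K n 2) _) (ex_intro _ u erefl))).

Lemma val_to_Z2 u : val (to_Z2 u) = bdry u.
Proof. by rewrite /to_Z2 -lock bdryE SubK. Qed.

Lemma to_Z2_surj (m : Z2 K n) : exists u, m = to_Z2 u.
Proof.
have /im_predP[u hu] := valP m; exists u; apply: val_inj.
by rewrite val_to_Z2 bdryE.
Qed.

Lemma val_Z2_linear a (u v : Z2 K n) : val (a *: u + v) = a *: val u + val v.
Proof. by rewrite linearP. Qed.

Lemma to_Z2_linear a u v : to_Z2 (a *: u + v) = a *: to_Z2 u + to_Z2 v.
Proof.
by apply: val_inj; rewrite val_Z2_linear !val_to_Z2 bdry_linear.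
Qed.

Definition beta (m : Z2 K n) : S^o := dotp (wsol L var) (val m).

Lemma beta_is_linear : linear beta.
Proof. by move=> a u v; rewrite /beta val_Z2_linear dotp_linear. Qed.

HB.instance Definition _ :=
  GRing.isLinear.Build S (Z2 K n) S^o _ beta beta_is_linear.

Lemma beta_to_Z2 u : beta (to_Z2 u) = wform u.
Proof. by rewrite /beta val_to_Z2 wformE. Qed.

Definition alpha (v : 'rV[S]_L.+1) : Z2 K n :=
  to_Z2 (relF (fun i => v 0 (inord i))).

Lemma alpha_is_linear : linear alpha.
Proof.
move=> a u v; rewrite /alpha -to_Z2_linear; congr to_Z2.
rewrite /relF scaler_sumr -big_split; apply: eq_bigr => i _.
by rewrite !mxE scalerDl scalerA.
Qed.

HB.instance Definition _ :=
  GRing.isLinear.Build S 'rV[S]_L.+1 (Z2 K n) _ alpha alpha_is_linear.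

Lemma relF_ext (c d : nat -> S) :
  (forall i, (i < L.+1)%N -> c i = d i) -> relF c = relF d.
Proof. by move=> h; apply: eq_bigr => i _; rewrite h. Qed.

Lemma alpha_row (c : nat -> S) : alpha (\row_i c i) = to_Z2 (relF c).
Proof.
rewrite /alpha (relF_ext (d := c)) // => i hi.
by rewrite mxE -[i]/(nat_of_ord (Ordinal hi)) inord_val.
Qed.

Lemma alpha_inj : injective alpha.
Proof.
move=> u v e; apply/eqP; rewrite -subr_eq0; apply/eqP/rowP => i; rewrite [RHS]mxE.
have h : alpha (u - v) = 0 by rewrite -scaleN1r addrC alpha_is_linear e scaleN1r addNr.
have := congr1 val h; rewrite val_to_Z2 => /bdry_relF_inj.
by move=> /(_ _ (ltn_ord i)); rewrite inord_val.
Qed.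

Lemma beta_ker m : beta m = 0 <-> exists v, alpha v = m.
Proof.
have [u ->] := to_Z2_surj m; rewrite beta_to_Z2; split=> [/wform_eq0[c hc]|[v hv]].
  exists (\row_i c i); apply: val_inj.
  by rewrite alpha_row (val_to_Z2 (relF c)) (val_to_Z2 u) hc.
rewrite -beta_to_Z2 -hv beta_to_Z2 wform_sum big1 // => i _.
by rewrite wform_fgen ?mulr0.
Qed.
End Bourbaki.

Theorem theorem5p10 (K : fieldType) (n : nat) (hn : (3 <= n)%N)
  (C : 'M[{mpoly K[n]}]_(rankN n, (rankN n).-1)) (hC : is_C C) :
  (forall q : {mpoly K[n]}, minors_ideal (rankN n).-1 C q ->
     exists p, q = bourbaki_factor K n * p) /\
  bourbaki_ideal (Z2 K n)
    (div_ideal (bourbaki_factor K n) (minors_ideal (rankN n).-1 C)).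
Proof.
case: n hn C hC => [|[|[|L]]] // _ C hC.
split=> [q /(minors_idealP hC)[u ->]|]; first by exists (wform u).
exists L.+1, (@alpha K L : {linear _ -> _}), (@beta K L : {linear _ -> _}).
split=> [|m|p]; [exact: alpha_inj | exact: beta_ker |].
have aI := mulfI (bourbaki_factor_neq0 K L).
rewrite /div_ideal (minors_idealP hC); split=> [[u /aI ->]|[m <-]].
  by exists (to_Z2 u); exact: beta_to_Z2.
have [u ->] := to_Z2_surj m; exists u; congr (_ * _); exact: beta_to_Z2.
Qed.
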